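(* Let $K\ge 1$ be an integer and consider an instance of the $K$-Matching Problem: $n_A,n_B\in\mathbb{Z}_+$; sets $A,B$ with $|A|=n_A$, $|B|=n_B$; for each $a\in A$ a family $P_a\subset\mathcal{P}(B)$ of subsets of $B$ with $|j|\le K$ for all $j\in P_a$; and weights $w_{aj}\in\mathbb{R}_+$ ($a\in A$, $j\in P_a$) with $\sum_{j\in P_a}e^{-w_{aj}}=1$ for every $a\in A$. Let $M=\sum_{a\in A}\sum_{j\in P_a}w_{aj}$. Let $G=(V,E)$ be the graph with vertex set $V=\{v_{aj}: a\in A,\ j\in P_a\}$ (one vertex for each pair $(a,j)$) and edge set $$E=\{(v_{aj},v_{aj'}) : a\in A,\ j,j'\in P_a,\ j\ne j'\}\ \cup\ \{(v_{aj},v_{a'j'}) : a,a'\in A,\ a\neq a',\ j\in P_a,\ j'\in P_{a'},\ j\cap j'\neq\emptyset\},$$ and give vertex $v_{aj}$ the weight $z_{aj}=M-w_{aj}$. Let $S$ be an optimal stable set of the Maximum Weighted Stable Set Problem on $G$ with weights $z$. Then the $K$-Matching Problem is feasible (i.e. the instance has a valid assignment) if and only if $z(S)>M\cdot(n_A-1)$; and, in that case, $f(a)=j$ for all $v_{aj}\in S$ is an optimal assignment of the $K$-Matching Problem.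
   Context: $\mathbb{R}_+$ denotes the nonnegative reals (zero weights are allowed), and $\mathcal{P}(B)$ is the power set of $B$; the empty set may belong to $P_a$. An assignment $f:A\to\mathcal{P}(B)$ is valid if $f(a)\in P_a$ for all $a\in A$ and $f(a_1)\cap f(a_2)=\emptyset$ for all $a_1\ne a_2$ in $A$. The weight of an assignment is $w(f)=\sum_{a\in A}w_{a f(a)}$. The $K$-Matching Problem asks for a valid assignment $f$ with $w(f)$ minimum; such an $f$ is called an optimal assignment. A stable set of a graph is a set of pairwise non-adjacent vertices. Given a graph $G=(V,E)$ and vertex weights $z$, the Maximum Weighted Stable Set Problem asks for a stable set $S\subset V$ of $G$ such that $z(S)=\sum_{v\in S}z_v$ is maximum; such an $S$ is called optimal.
   Formalization: The formal theorem adds the assumption M > 0; without it the claim fails, e.g. for n_A = n_B = 1, P_a = {∅}, w = 0, where the instance is feasible but z(S) = 0 is not greater than M(n_A − 1) = 0. *)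

(* Defs.v *)
From mathcomp Require Import all_boot all_order all_algebra.
From mathcomp Require Import reals.
Set Implicit Arguments.
Unset Strict Implicit.
Unset Printing Implicit Defensive.
Import Order.TTheory GRing.Theory Num.Theory.
Local Open Scope ring_scope.

Section StableSet.
Variables (R : realType) (V : finType) (e : rel V) (z : V -> R).

Definition stable_set (S : {set V}) : Prop :=
  {in S &, forall u v, ~~ e u v}.

Definition set_weight (S : {set V}) : R := \sum_(v in S) z v.

Definition optimal_stable_set (S : {set V}) : Prop :=
  stable_set S /\ forall T, stable_set T -> set_weight T <= set_weight S.

End StableSet.

Section KMatching.
Variables (R : realType) (A B : finType).
(* [w a j] is meaningful only when [j \in P a]; other values are never used. *)
Variables (P : A -> {set {set B}}) (w : A -> {set B} -> R).

Definition valid_assignment (f : {ffun A -> {set B}}) : Prop :=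
  (forall a, f a \in P a) /\
  (forall a1 a2, a1 != a2 -> f a1 :&: f a2 = set0).

Definition assignment_weight (f : {ffun A -> {set B}}) : R :=
  \sum_a w a (f a).

Definition optimal_assignment (f : {ffun A -> {set B}}) : Prop :=
  valid_assignment f /\
  forall g, valid_assignment g -> assignment_weight f <= assignment_weight g.

Definition feasible : Prop := exists f, valid_assignment f.

Definition total_weight : R := \sum_a \sum_(j in P a) w a j.

(* The vertex v_aj is the pair (a, j) together with a proof of [j \in P a]. *)
Definition vertex : finType := {v : A * {set B} | v.2 \in P v.1}.

Definition edge : rel vertex := fun u v =>
  let: (a, j) := val u in let: (a', j') := val v in
  ((a == a') && (j != j')) || ((a != a') && (j :&: j' != set0)).

Definition vertex_weight (v : vertex) : R :=
  total_weight - w (val v).1 (val v).2.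

(* The pairs (a, j) with v_aj in S form exactly the graph of f: each a occurs
   in S, with f a as its only partner. *)
Definition read_off (S : {set vertex}) (f : {ffun A -> {set B}}) : Prop :=
  forall a j, f a = j <-> exists2 v, v \in S & val v = (a, j).

End KMatching.

(* Main.v *)
Require Import Defs.
From mathcomp Require Import all_boot all_order all_algebra.
From mathcomp Require Import reals sequences exp.
From mathcomp Require Import lra.
Set Implicit Arguments.
Unset Strict Implicit.
Unset Printing Implicit Defensive.
Import Order.TTheory GRing.Theory Num.Theory.
Local Open Scope ring_scope.

(* Two vertices with the same [a] are adjacent, so a stable set has at most one
   vertex per [a], and the stable sets of size [n_A] are exactly the graphs of
   valid assignments, with [z(S) = n_A M - w(f)].  As [z <= M], a stable set of
   weight above [M (n_A - 1)] must have size [n_A].  Conversely [w(f) < M] for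
   every valid [f]: otherwise all weights not used by [f] vanish, and then the
   normalization forces [P a = {f a}] and [w a (f a) = 0] for all [a], contrary
   to [0 < M]. *)

Section Normalization.
Variables (R : realType) (A B : finType).
Variables (P : A -> {set {set B}}) (w : A -> {set B} -> R).
Hypothesis w_ge0 : forall a j, j \in P a -> 0 <= w a j.
Hypothesis w_norm : forall a, \sum_(j in P a) expR (- w a j) = 1.

Lemma weight_le_sum a j : j \in P a -> w a j <= \sum_(i in P a) w a i.
Proof.
move=> Pj; rewrite (bigD1 j) //= lerDl.
by apply: sumr_ge0 => i /andP[/w_ge0].
Qed.

Lemma weight_lt_sum a j : j \in P a -> 0 < \sum_(i in P a) w a i ->
  w a j < \sum_(i in P a) w a i.
Proof.
move=> Pj; have := w_norm a.
have rest_ge0 i : (i \in P a) && (i != j) -> 0 <= w a i by case/andP => /w_ge0.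
rewrite !(bigD1 j Pj) /= ltrDl => norm sum_gt0.
rewrite lt_neqAle eq_sym sumr_ge0 // andbT; apply/negP => /eqP rest0.
have [i Pi|Pj_only] := pickP [pred i | (i \in P a) && (i != j)].
  have wi0 : w a i = 0 by apply: (psumr_eq0P rest_ge0 rest0).
  (* A second set [i] of weight 0 contributes [expR 0 = 1]; with the positive term of [j], the
     normalized sum would exceed 1. *)
  move: norm; rewrite (bigD1 i) //= wi0 oppr0 expR0 => norm.
  have rest_exp : 0 <= \sum_(k | (k \in P a) && (k != j) && (k != i)) expR (- w a k).
    by apply: sumr_ge0 => k _; exact: expR_ge0.
  by have := expR_gt0 (- w a j); lra.
(* Now [P a] is the singleton of [j], and the normalization reads [expR (- w a j) = expR 0]. *)
move: norm sum_gt0; rewrite !(big_pred0 _ _ _ _ Pj_only) !addr0 -expR0.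
by move=> /expR_inj /eqP; rewrite oppr_eq0 => /eqP ->; rewrite ltxx.
Qed.

(** Since [M > 0], some [a] has a positive sum of weights; strictness there is enough, as every
    other [a] contributes at most its own sum. *)
Lemma assignment_weight_lt_total (f : {ffun A -> {set B}}) :
  0 < total_weight P w -> (forall a, f a \in P a) ->
  assignment_weight w f < total_weight P w.
Proof.
move=> M_gt0 fP.
have [a sum_gt0|sum_le0] := pickP [pred a | 0 < \sum_(j in P a) w a j].
  rewrite /assignment_weight /total_weight (bigD1 a) //= [ltRHS](bigD1 a) //=.
  apply: ltr_leD; first exact: weight_lt_sum.
  by apply: ler_sum => b _; exact: weight_le_sum.
have : total_weight P w <= 0.
  by apply: sumr_le0 => a _; rewrite leNgt; have /= -> := sum_le0 a.
by rewrite leNgt M_gt0.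
Qed.

End Normalization.

Section StableSets.
Variables (R : realType) (A B : finType).
Variables (P : A -> {set {set B}}) (w : A -> {set B} -> R).
Implicit Types (S : {set vertex P}) (f : {ffun A -> {set B}}).

Lemma read_offE S f v : read_off S f -> v \in S -> f (val v).1 = (val v).2.
Proof. by move=> Sf Sv; apply/Sf; exists v => //; case: (val v). Qed.

Lemma read_off_inj S f : read_off S f -> {in S &, injective (fun v => (val v).1)}.
Proof.
move=> Sf u v Su Sv uv; apply/val_inj/injective_projections => //.
by rewrite -(read_offE Sf Su) -(read_offE Sf Sv); congr (f _).
Qed.

Lemma read_off_imset S f : read_off S f -> [set (val v).1 | v in S] = setT.
Proof.
move=> Sf; apply/setP => a; rewrite inE; apply/imsetP.
by have [v Sv va] := (Sf a (f a)).1 erefl; exists v => //; rewrite va.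
Qed.

Lemma read_off_weight S f : read_off S f ->
  set_weight (vertex_weight w) S = total_weight P w * #|A|%:R - assignment_weight w f.
Proof.
move=> Sf; rewrite mulr_natr -sumr_const -sumrB.
(* The first component is a bijection from [S] onto [A], so the sum over [S] is reindexed by [A]. *)
transitivity (\sum_(a in [set (val v).1 | v in S]) (total_weight P w - w a (f a))).
  rewrite big_imset; last exact: read_off_inj Sf.
  by apply: eq_bigr => v Sv; rewrite /vertex_weight /= (read_offE Sf Sv).
by rewrite (read_off_imset Sf); apply: eq_bigl => a; rewrite inE.
Qed.

(** Membership in [P a] is built into the vertices, and the graph of a function has no edge between
    distinct sets of the same [a]. Only the edges between intersecting sets remain, and their
    absence is disjointness. *)
Lemma read_off_stable S f : read_off S f ->
  stable_set (@edge A B P) S <-> valid_assignment P f.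
Proof.
move=> Sf; split=> [stS|[fP fI] u v Su Sv].
  split=> [a|a b ab].
    by have [v Sv va] := (Sf a (f a)).1 erefl; have := valP v; rewrite va.
  have [u Su ua] := (Sf a (f a)).1 erefl; have [v Sv vb] := (Sf b (f b)).1 erefl.
  have := stS u v Su Sv; rewrite /edge ua vb ab (negbTE ab) /= negbK.
  by move/eqP.
have := read_offE Sf Su; have := read_offE Sf Sv; rewrite /edge.
case: (val u) (val v) => [a j] [b i] /= <- <-.
by have [->|ab] /= := eqVneq a b; rewrite ?eqxx //= fI // eqxx.
Qed.

(** This turns any competing assignment into a vertex set that can be compared with the optimal
    [S]. *)
Lemma read_off_graph f : (forall a, f a \in P a) ->
  read_off [set v : vertex P | f (val v).1 == (val v).2] f.
Proof.
move=> fP a j; split=> [<-|[v]]; last by rewrite inE => /eqP + va; rewrite va.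
by exists (exist _ (a, f a) (fP a)); rewrite ?inE.
Qed.

Lemma stable_inj S : stable_set (@edge A B P) S ->
  {in S &, injective (fun v => (val v).1)}.
Proof.
move=> stS [[a j] Pj] [[b i] Pi] Su Sv /= ab; apply/val_inj => /=.
by have := stS _ _ Su Sv; rewrite /edge /= ab eqxx orbF negbK => /eqP ->.
Qed.

Lemma stable_read_off S : stable_set (@edge A B P) S -> (#|A| <= #|S|)%N ->
  exists f, read_off S f.
Proof.
move=> stS cardS; have inj := stable_inj stS.
(* The first component is injective on [S], so [#|A| <= #|S|] makes it surjective; [f a] is then the
   partner of [a] in its unique vertex of [S]. *)
have onto a : exists v, (v \in S) && ((val v).1 == a).
  have : a \in [set (val v).1 | v in S].
    suff -> : [set (val v).1 | v in S] = setT by rewrite inE.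
    by apply/eqP; rewrite eqEcard subsetT cardsT card_in_imset.
  by case/imsetP => v Sv ->; exists v; rewrite Sv eqxx.
have choiceP a := andP (xchooseP (onto a)).
exists [ffun a => (val (xchoose (onto a))).2] => a j; rewrite ffunE.
have [Sx /eqP xa] := choiceP a; split=> [<-|[v Sv va]].
  by exists (xchoose (onto a)) => //; apply: injective_projections.
by rewrite (inj _ _ Sx Sv) ?xa va.
Qed.

End StableSets.

Theorem theorem2p1 (R : realType) (K nA nB : nat) (A B : finType)
    (P : A -> {set {set B}}) (w : A -> {set B} -> R) (S : {set vertex P})
    (K_ge1 : (1 <= K)%N) (cardA : #|A| = nA) (cardB : #|B| = nB)
    (P_le_K : forall a j, j \in P a -> (#|j| <= K)%N)
    (w_ge0 : forall a j, j \in P a -> 0 <= w a j)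
    (w_norm : forall a, \sum_(j in P a) expR (- w a j) = 1)
    (M_gt0 : 0 < total_weight P w)
    (S_opt : optimal_stable_set (@edge A B P) (vertex_weight w) S) :
  (feasible P <->
     total_weight P w * (nA%:R - 1) < set_weight (vertex_weight w) S) /\
  (feasible P -> exists f, read_off S f /\ optimal_assignment P w f).
Proof.
have [stS maxS] := S_opt.
have graph_le g : valid_assignment P g ->
    total_weight P w * nA%:R - assignment_weight w g
      <= set_weight (vertex_weight w) S.
  move=> gV; have Gg := read_off_graph gV.1.
  by rewrite -cardA -(read_off_weight w Gg); apply/maxS/(read_off_stable Gg).
have heavy_full : total_weight P w * (nA%:R - 1) < set_weight (vertex_weight w) S ->
    exists f, read_off S f.
  move=> heavy; apply: stable_read_off => //.
  have : set_weight (vertex_weight w) S <= total_weight P w * #|S|%:R.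
    rewrite mulr_natr -sumr_const; apply: ler_sum => v _.
    by rewrite gerBl; apply/w_ge0/(valP v).
  (* Cancelling [M > 0] leaves [nA - 1 < #|S|], which for integers means [nA <= #|S|]. *)
  move/(lt_le_trans heavy); rewrite ltr_pM2l // ltrBlDr natr1 ltr_nat ltnS.
  by rewrite cardA.
have feasible_heavy : feasible P ->
    total_weight P w * (nA%:R - 1) < set_weight (vertex_weight w) S.
  move=> [g gV]; apply: lt_le_trans (graph_le g gV).
  (* Removing the common term [M * nA] leaves [w(g) < M]. *)
  by rewrite mulrBr mulr1 ltrD2l ltrN2; apply: assignment_weight_lt_total gV.1.
split; first split=> // /heavy_full[f Sf]; first by exists f; apply/(read_off_stable Sf).
move=> /feasible_heavy/heavy_full[f Sf]; exists f; split=> //.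
split=> [|g /graph_le]; first exact/(read_off_stable Sf).
(* Both sides are [M * nA] minus an assignment weight, so maximality of [S] is minimality of [f]. *)
by rewrite (read_off_weight w Sf) cardA lerD2l lerN2.
Qed.
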